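(* Let $n\ge 1$ be an integer and let $a(s)=s^n+a_1s^{n-1}+\cdots+a_n\in H^n$ be a monic real Hurwitz stable polynomial of order $n$. If $(x_1,x_2,\dots,x_{n-1})\in\Omega^W_{1a}$, then for every $(1,\alpha_1,\alpha_2,\dots,\alpha_n)\in\mathbb{R}^{n+1}$ and all sufficiently small $\varepsilon>0$ (that is, there is $\varepsilon_0>0$, depending on the given data, such that for every $0<\varepsilon<\varepsilon_0$) we have $$(0,1,x_1,x_2,\dots,x_{n-1})+\varepsilon(1,\alpha_1,\alpha_2,\dots,\alpha_n)\in\Omega_a.$$
   Context: $P^n$ denotes the set of real polynomials of order (exact degree) $n$. $H^n\subset P^n$ denotes the set of Hurwitz stable polynomials of order $n$ (all roots have negative real part). Let $j$ be the imaginary unit. A rational function $p(s)=b(s)/a(s)$ is called strictly positive real (SPR), of order $n$, if $b\in P^n$, $a\in H^n$, and $\mathrm{Re}[p(j\omega)]>0$ for all $\omega\in\mathbb{R}$; it is called weak strictly positive real (WSPR), of order $n$, if $b\in P^{n-1}$, $a\in H^n$, and $\mathrm{Re}[p(j\omega)]>0$ for all $\omega\in\mathbb{R}$. For $a\in H^n$, $\Omega_a\subset\mathbb{R}^{n+1}$ is the set of coefficient vectors $(b_0,b_1,\dots,b_n)$ of all $b(s)=b_0s^n+b_1s^{n-1}+\cdots+b_n\in P^n$ such that $b(s)/a(s)$ is SPR. For a monic $a\in H^n$, $\Omega^W_{1a}$ is the set of all $(x_1,x_2,\dots,x_{n-1})\in\mathbb{R}^{n-1}$ such that, with $b(s)=s^{n-1}+x_1s^{n-2}+\cdots+x_{n-1}$,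 the rational function $b(s)/a(s)$ is WSPR. *)

(* Defs.v *)
From mathcomp Require Import all_boot all_order all_algebra.
From mathcomp Require Import classical_sets reals complex.

Set Implicit Arguments.
Unset Strict Implicit.
Unset Printing Implicit Defensive.

Import Order.TTheory GRing.Theory Num.Theory.
Local Open Scope classical_set_scope.
Local Open Scope complex_scope.
Local Open Scope ring_scope.

Section PositiveReal.
Variable R : realType.

Definition Pn (n : nat) : set {poly R} := [set p | size p = n.+1].

Definition complex_poly (p : {poly R}) : {poly R[i]} :=
  map_poly (real_complex R) p.

Definition Hn (n : nat) : set {poly R} :=
  [set p | Pn n p /\ forall z : R[i], root (complex_poly p) z -> complex.Re z < 0].

(* The value at j * w of the rational function b / a. *)
Definition freq_resp (b a : {poly R}) (w : R) : R[i] :=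
  let jw := 0 +i* w in (complex_poly b).[jw] / (complex_poly a).[jw].

Definition SPR (n : nat) (b a : {poly R}) : Prop :=
  [/\ Pn n b, Hn n a & forall w : R, 0 < complex.Re (freq_resp b a w)].

(* Only meaningful for 0 < n, since n.-1 truncates at 0. *)
Definition WSPR (n : nat) (b a : {poly R}) : Prop :=
  [/\ Pn n.-1 b, Hn n a & forall w : R, 0 < complex.Re (freq_resp b a w)].

(* Coefficients are listed from the highest power down:
   v = (v_0, ..., v_n) is v_0 s^n + v_1 s^(n-1) + ... + v_n. *)
Definition poly_of_coefs (n : nat) (v : 'rV[R]_n.+1) : {poly R} :=
  \sum_(i < n.+1) v 0 i *: 'X^(n - i).

Definition Omega (n : nat) (a : {poly R}) : set 'rV[R]_n.+1 :=
  [set v | SPR n (poly_of_coefs v) a].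

(* row_mx 1 x is the coefficient vector (1, x_1, ..., x_(n-1)). *)
Definition OmegaW1 (n : nat) (a : {poly R}) : set 'rV[R]_n.-1 :=
  [set x | WSPR n (@poly_of_coefs n.-1 (row_mx (1 : 'rV_1) x)) a].

End PositiveReal.

Arguments Omega {R} n a _.
Arguments OmegaW1 {R} n a _.

(* Main.v *)
Require Import Defs.
From mathcomp Require Import all_boot all_order all_algebra.
From mathcomp Require Import classical_sets reals complex.
From mathcomp Require Import polyrcf topology normedtype derive.

Set Implicit Arguments.
Unset Strict Implicit.
Unset Printing Implicit Defensive.

Import Order.TTheory GRing.Theory Num.Theory.
Import numFieldNormedType.Exports.
Local Open Scope ring_scope.

(* The sign of Re (b/a)(jw) is that of the real polynomial
   B(w) = Re (b(jw) conj(a(jw))), which is linear in b.  For a monic c of the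
   same order n as a, the corresponding polynomial C has leading term w^(2n),
   so C is positive off a compact interval.  On that interval B is bounded below
   by a positive constant and C is bounded, hence B + eps C > 0 everywhere for
   small eps > 0. *)

(** Odd size means even degree, so substituting [- 'X] keeps the leading coefficient. The behaviour
    at plus infinity, applied to [q] and to [q \Po - 'X], then settles both ends of the line. *)
Lemma poly_gt0_outside (R : realFieldType) (q : {poly R}) :
  odd (size q) -> 0 < lead_coef q ->
  exists2 W : R, 0 <= W & forall w, W <= `|w| -> 0 < q.[w].
Proof.
move=> q_odd q_gt0.
have size_NX : size (- 'X : {poly R}) = 2%N by rewrite size_polyN size_polyX.
have lead_qN : lead_coef (q \Po - 'X) = lead_coef q.
  rewrite lead_coef_comp ?size_NX // lead_coefN lead_coefX -signr_odd.
  by case: (size q) q_odd => //= m /negbTE ->; rewrite mulr1.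
have [u qu] := poly_pinfty_gt_lc q_gt0.
have [v qv] : exists v, forall w, v <= w -> lead_coef q <= q.[- w].
  have [|v qv] := @poly_pinfty_gt_lc _ (q \Po - 'X); first by rewrite lead_qN.
  by exists v => w /qv; rewrite lead_qN horner_comp hornerN hornerX.
exists (`|u| + `|v|); first by rewrite addr_ge0.
move=> w W_le; have [w_ge0|w_lt0] := lerP 0 w.
  apply: lt_le_trans q_gt0 (qu _ _); rewrite (ger0_norm w_ge0) in W_le.
  by rewrite (le_trans (ler_norm u)) // (le_trans _ W_le) // lerDl.
apply: lt_le_trans q_gt0 _; rewrite -[w]opprK; apply: qv.
rewrite (ltr0_norm w_lt0) in W_le.
by rewrite (le_trans (ler_norm v)) // (le_trans _ W_le) // lerDr.
Qed.

Lemma poly_gt0_perturb (R : realType) (p q : {poly R}) :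
    (forall w, 0 < p.[w]) -> odd (size q) -> 0 < lead_coef q ->
  exists2 eps0 : R, 0 < eps0 &
    forall eps, 0 < eps < eps0 -> forall w, 0 < (p + eps *: q).[w].
Proof.
move=> p_gt0 q_odd q_gt0; have [W W_ge0 q_out] := poly_gt0_outside q_odd q_gt0.
have [||c _ p_min] := @EVT_min R (horner p) (- W) W.
- by rewrite (le_trans _ W_ge0) // oppr_le0.
- by apply: continuous_subspaceT => w; apply: continuous_horner.
have [M q_bnd] := poly_itv_bound q (- W) W.
have M1_gt0 : 0 < `|M| + 1 by rewrite ltr_wpDl.
(* Here [p.[c]] is the minimum of [p] on [[-W, W]] and [|M|] bounds [|q|] there; adding 1 keeps the
   denominator positive when [M] is 0. *)
exists (p.[c] / (`|M| + 1)) => [|eps /andP[eps_gt0 eps_lt] w].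
  by rewrite divr_gt0.
rewrite hornerD hornerZ.
have [/q_out qw_gt0|w_lt] := lerP W `|w|.
  by rewrite addr_gt0 // mulr_gt0.
have w_itv : - W <= w <= W by rewrite -ler_norml ltW.
have pw : p.[c] <= p.[w] by apply: p_min; rewrite in_itv.
have qw : `|q.[w]| <= `|M| by rewrite (le_trans (q_bnd w w_itv)) // ler_norm.
have epsM : eps * (`|M| + 1) < p.[c] by rewrite -ltr_pdivlMr.
(* The chain is - eps q(w) <= eps (|M| + 1) < p(c) <= p(w). *)
rewrite -ltrBlDr sub0r (lt_le_trans _ pw) // (le_lt_trans _ epsM) //.
rewrite -mulrN ler_wpM2l ?(ltW eps_gt0) //.
by rewrite (le_trans (ler_norm _)) // normrN (le_trans qw) // lerDl.
Qed.

Section FrequencyNumerator.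
Variable R : realType.
Implicit Types a b c : {poly R}.

(** For real w, -jw is the conjugate of jw and [a] has real coefficients, so the second factor takes
    the value conj(a(jw)). Conjugation is thus expressed by a polynomial in w. *)
Definition freq_prod b a : {poly R[i]} :=
  (complex_poly b \Po ('i%C *: 'X)) * (complex_poly a \Po (- 'i%C *: 'X)).

Definition freq_num b a : {poly R} :=
  \poly_(k < size (freq_prod b a)) complex.Re (freq_prod b a)`_k.

Lemma Re_sum I (r : seq I) (F : I -> R[i]) :
  complex.Re (\sum_(i <- r) F i) = \sum_(i <- r) complex.Re (F i).
Proof. by elim/big_rec2: _ => // i y1 y2 _ <-; case: (F i) y2 => ? ? []. Qed.

(** Powers of a real w are real, so taking real parts coefficientwise commutes with evaluation at
    w. *)
Lemma horner_Re (p : {poly R[i]}) (w : R) :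
  (\poly_(k < size p) complex.Re p`_k).[w] = complex.Re p.[w%:C%C].
Proof.
rewrite horner_poly horner_coef Re_sum; apply: eq_bigr => k _.
by rewrite -rmorphXn /=; case: (p`_k) => u v /=; rewrite mulr0 subr0.
Qed.

Lemma conj_complex_poly a (z : R[i]) :
  (complex_poly a).[z^*%C] = (complex_poly a).[z]^*%C.
Proof.
rewrite /complex_poly -horner_map -map_poly_comp /=.
by congr (_.[_]); apply: eq_map_poly => u /=; rewrite oppr0.
Qed.

Lemma horner_freq_num b a w :
  (freq_num b a).[w] =
  complex.Re ((complex_poly b).[Complex 0 w] * (complex_poly a).[Complex 0 w]^*%C).
Proof.
rewrite horner_Re hornerM !horner_comp !hornerZ hornerX -conj_complex_poly.
by congr (complex.Re (_.[_] * _.[_])); simpc.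
Qed.

Lemma freq_num_linear b c a (k : R) :
  freq_num (b + k *: c) a = freq_num b a + k *: freq_num c a.
Proof.
apply/polyP => i; rewrite coefD coefZ.
(* The truncation bound depends on [d]; beyond it the coefficient of [freq_prod] is 0, whose real
   part is also 0, so the formula holds at every index. *)
have coefE d : (freq_num d a)`_i = complex.Re (freq_prod d a)`_i.
  by rewrite coef_poly; case: ltnP => // /(nth_default 0) ->.
rewrite !coefE /freq_prod /complex_poly rmorphD /= map_polyZ /=.
rewrite comp_polyD comp_polyZ mulrDl -scalerAl coefD coefZ.
by do 2![case: (_`_i) => ? ?]; rewrite /= mul0r subr0.
Qed.

(** Since u / v = u conj(v) / |v|^2, the two real parts differ by a positive real factor. *)
Lemma Re_freq_resp_gt0 b a w : (complex_poly a).[Complex 0 w] != 0 ->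
  (0 < complex.Re (freq_resp b a w)) = (0 < (freq_num b a).[w]).
Proof.
rewrite horner_freq_num /freq_resp /=.
set v := (complex_poly a).[_]; set u := _.[_] => v_neq0.
have -> : u / v = (`|v| ^- 2) * (u * v^*%C) by rewrite invc_norm mulrCA.
have : 0 < `|v| ^- 2 by rewrite invr_gt0 exprn_gt0 // normr_gt0.
rewrite ltcE /= => /andP[/eqP im0 t_gt0].
have -> t z : complex.Im t = 0 -> complex.Re (t * z) = complex.Re t * complex.Re z.
- by case: t z => t1 t2 [z1 z2] /= ->; rewrite mul0r subr0.
- by rewrite pmulr_rgt0.
- by rewrite -im0.
Qed.

Lemma Hn_axis_neq0 n a w : Hn n a -> (complex_poly a).[Complex 0 w] != 0.
Proof. by case=> _ a_roots; apply/negP => /a_roots /=; rewrite ltxx. Qed.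

(** The top coefficient of the product is i^n (-i)^n = (-i^2)^n = 1. Being real and nonzero, it
    survives taking real parts, so the degree stays 2n. *)
Lemma freq_num_monic n b a : b \is monic -> a \is monic ->
  size b = n.+1 -> size a = n.+1 ->
  size (freq_num b a) = n.*2.+1 /\ lead_coef (freq_num b a) = 1.
Proof.
move=> /monicP b1 /monicP a1 size_b size_a.
have i_neq0 : 'i%C != 0 :> R[i] by rewrite eq_complex /= oner_eq0 andbF.
have size_iX (z : R[i]) : z != 0 -> size (z *: 'X) = 2%N.
  by move=> z0; rewrite size_scale ?size_polyX.
have iX := size_iX _ i_neq0.
have NiX : size (- 'i%C *: 'X : {poly R[i]}) = 2%N by rewrite size_iX ?oppr_eq0.
have size_p : size (freq_prod b a) = n.*2.+1.
  rewrite size_mul -?size_poly_gt0 ?size_comp_poly2 ?size_map_poly ?size_b ?size_a //.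
  by rewrite addnS addSn addnn.
have lead_p : lead_coef (freq_prod b a) = 1.
  rewrite lead_coefM !lead_coef_comp ?iX ?NiX //.
  rewrite !lead_coefZ lead_coefX !mulr1 !lead_coef_map b1 a1 !rmorph1 !mul1r.
  by rewrite !size_map_poly size_b size_a -exprMn mulrN -expr2 sqr_i opprK expr1n.
have lead_num : complex.Re (freq_prod b a)`_n.*2 = 1.
  by rewrite -[n.*2]/(n.*2.+1.-1) -size_p -lead_coefE lead_p.
have size_num : size (freq_num b a) = n.*2.+1.
  by rewrite /freq_num size_p size_poly_eq // lead_num oner_neq0.
by rewrite lead_coefE size_num coef_poly size_p ltnSn lead_num.
Qed.

End FrequencyNumerator.

Section CoefficientVectors.
Variable R : realType.

Lemma poly_of_coefs_linear n (u v : 'rV[R]_n.+1) (k : R) :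
  poly_of_coefs (u + k *: v) = poly_of_coefs u + k *: poly_of_coefs v.
Proof.
rewrite /poly_of_coefs scaler_sumr -big_split /=; apply: eq_bigr => i _.
by rewrite !mxE scalerDl scalerA.
Qed.

Lemma coef_poly_of_coefs n (v : 'rV[R]_n.+1) : (poly_of_coefs v)`_n = v 0 0.
Proof.
rewrite coef_sum big_ord_recl big1 => [|i _].
  by rewrite coefZ coefXn subn0 eqxx mulr1 addr0.
rewrite coefZ coefXn /= eqn_leq [X in _ && X]leq_subr andbT.
(* A later entry has exponent strictly below n; the strict inequality needs 0 < n, which the
   existence of [i] in ['I_n] provides. *)
by rewrite leqNgt ltn_subrL /= (leq_ltn_trans _ (ltn_ord i)) ?mulr0.
Qed.

Lemma size_poly_of_coefs n (v : 'rV[R]_n.+1) : v 0 0 != 0 ->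
  size (poly_of_coefs v) = n.+1.
Proof.
move=> v0; apply/eqP; rewrite eqn_leq; apply/andP; split; last first.
  rewrite ltnNge; apply: contra v0 => le_n.
  by rewrite -coef_poly_of_coefs nth_default.
apply: (leq_trans (size_sum _ _ _)); apply/bigmax_leqP => i _.
by rewrite (leq_trans (size_scale_leq _ _)) // size_polyXn ltnS leq_subr.
Qed.

Lemma row_mx_head n (u : 'rV[R]_1) (y : 'rV[R]_n) :
  (row_mx u y : 'rV_n.+1) 0 0 = u 0 0.
Proof. by rewrite mxE; case: splitP => // j _; rewrite ord1. Qed.

Lemma row_mx_behead n (u : 'rV[R]_1) (y : 'rV[R]_n) i :
  (row_mx u y : 'rV_n.+1) 0 (lift ord0 i) = y 0 i.
Proof.
have -> : lift ord0 i = rshift 1 i by apply: val_inj.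
exact: row_mxEr.
Qed.

(** The leading zero kills the top power, and shifting the index by one leaves the other exponents
    unchanged. *)
Lemma poly_of_coefs_row0 n (y : 'rV[R]_n.+1) :
  @poly_of_coefs R n.+1 (row_mx (0 : 'rV_1) y) = poly_of_coefs y.
Proof.
rewrite /poly_of_coefs big_ord_recl row_mx_head mxE scale0r add0r.
by apply: eq_bigr => i _; rewrite row_mx_behead.
Qed.

End CoefficientVectors.

(* The order of a is n.+1, which ranges over all integers >= 1. *)
Theorem theorem4 (R : realType) (n : nat) (a : {poly R})
    (a_monic : a \is monic) (a_hurwitz : Hn n.+1 a)
    (x : 'rV[R]_n) (x_in : OmegaW1 n.+1 a x) (alpha : 'rV[R]_n.+1) :
  exists2 eps0 : R, 0 < eps0 &
    forall eps : R, 0 < eps < eps0 ->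
      Omega n.+1 a
        (row_mx (0 : 'rV_1) (row_mx (1 : 'rV_1) x)
         + eps *: row_mx (1 : 'rV_1) alpha).
Proof.
case: x_in => _ _ b_pos; set b := poly_of_coefs _ in b_pos.
have a_neq0 w := Hn_axis_neq0 w a_hurwitz.
(* The direction of perturbation starts with 1, so its polynomial is monic of the same order as
   [a]. *)
pose cv : 'rV[R]_n.+2 := row_mx (1 : 'rV_1) alpha.
have cv0 : cv 0 0 = 1 by rewrite [LHS]row_mx_head mxE.
have size_c : size (poly_of_coefs cv) = n.+2.
  by rewrite size_poly_of_coefs ?cv0 ?oner_neq0.
have c_monic : poly_of_coefs cv \is monic.
  by rewrite monicE lead_coefE size_c coef_poly_of_coefs cv0.
have [size_num lead_num] :=
  freq_num_monic c_monic a_monic size_c a_hurwitz.1.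
have [w|||eps0 eps0_gt0 eps0P] :=
    @poly_gt0_perturb R (freq_num b a) (freq_num (poly_of_coefs cv) a).
- by rewrite -Re_freq_resp_gt0.
- by rewrite size_num /= odd_double.
- by rewrite lead_num.
exists eps0 => // eps eps_itv; rewrite /Omega /=; split=> //.
(* The perturbed vector has head 0 + eps, which is nonzero, so the order rises to exactly that of
   [a]. *)
- apply: size_poly_of_coefs; rewrite mxE [X in X + _]row_mx_head mxE add0r.
  by rewrite mxE -/cv cv0 mulr1; case/andP: eps_itv => /gt_eqF ->.
- move=> w; rewrite Re_freq_resp_gt0 //.
  by rewrite poly_of_coefs_linear poly_of_coefs_row0 freq_num_linear eps0P.
Qed.
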